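(* Let $G$ be a locally compact second countable group, $E$ a locally compact second countable $G$-space, $\mu$ a Borel probability measure on $G$ and $\lambda$ a $\mu$-stationary (positive Radon) measure on $E$. Then there exists a unique $\hat\theta$-invariant measure on $\hat\Omega\times E$ which has projection $\tilde\lambda=\mathbb{P}\otimes\lambda$ on $\Omega\times E$.
   Context: $\lambda$ is $\mu$-stationary if $\mu*\lambda=\int g\lambda\,d\mu(g)=\lambda$, where $g\lambda$ is the push-forward of $\lambda$ by $g$. $\Omega=G^{\mathbb{N}}$ ($\mathbb{N}=\{1,2,\dots\}$) has coordinates $Y_1,Y_2,\dots$, and $\mathbb{P}=\mu^{\mathbb{N}}$. $\hat\Omega=G^{\mathbb{Z}}$ with coordinates $Y_k$, $k\in\mathbb{Z}$, and shift $\theta$ ($Y_k(\theta\hat\omega)=Y_{k+1}(\hat\omega)$); $\omega\in\Omega$ denotes the projection of $\hat\omega\in\hat\Omega$ onto the coordinates of index $\ge1$. The map $\hat\theta$ on $\hat\Omega\times E$ is $\hat\theta(\hat\omega,x)=(\theta\hat\omega,Y_1(\omega)x)$. The projection $\hat\Omega\times E\to\Omega\times E$ is $(\hat\omega,x)\mapsto(\omega,x)$. *)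

(* Defs.v *)
From HB Require Import structures.
From mathcomp Require Import all_boot all_order all_algebra.
From mathcomp Require Import all_classical all_reals all_analysis.

Set Implicit Arguments.
Unset Strict Implicit.
Unset Printing Implicit Defensive.

Import Order.TTheory GRing.Theory Num.Theory.
Import numFieldNormedType.Exports.

Local Open Scope classical_set_scope.
Local Open Scope ring_scope.

(* Measurable types are pointed in the library, hence so is the carrier of a
   topological group below; the distinguished point plays no role. *)
HB.structure Definition PreTopologicalGroup :=
  {G of PointedTopological G & Group G}.

HB.mixin Record PreTopologicalGroup_isTopologicalGroup G
    & PreTopologicalGroup G := {
  mulg_continuous : continuous (fun p : G * G => (p.1 * p.2)%g) ;
  invg_continuous : continuous (fun g : G => (g^-1)%g)
}.

#[short(type="topologicalGroupType")]
HB.structure Definition TopologicalGroup :=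
  {G of PreTopologicalGroup G & PreTopologicalGroup_isTopologicalGroup G}.

(* Local compactness includes the Hausdorff property, as is customary. *)
Definition lcsc (T : topologicalType) : Prop :=
  [/\ hausdorff_space T, locally_compact [set: T] & @second_countable T].

Definition continuous_action (G : topologicalGroupType) (E : topologicalType)
    (act : G -> E -> E) : Prop :=
  [/\ forall x, act 1%g x = x,
      forall g h x, act (g * h)%g x = act g (act h x) &
      continuous (fun p : G * E => act p.1 p.2)].

Definition borel_display : measure_display. Proof. exact. Qed.
Definition product_display : measure_display -> measure_display.
Proof. exact. Qed.

Section borel.
Context (T : ptopologicalType).

Definition borel : Type := T.

HB.instance Definition _ := Pointed.on borel.
HB.instance Definition _ := @isMeasurable.Build borel_display borel
  <<s (@open T) >> (@sigma_algebra0 _ setT (@open T))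
  (@sigma_algebraC T (@open T)) (@sigma_algebra_bigcup _ setT (@open T)).

End borel.

(* I -> T with the product sigma-algebra, generated by the coordinate maps *)
Section product_space.
Context (I : Type) d (T : measurableType d).

Definition coordinate_sets : set (set (I -> T)) :=
  \bigcup_(i in [set: I])
    preimage_set_system setT (fun w : I -> T => w i) measurable.

Definition product_space : Type := I -> T.

HB.instance Definition _ := Pointed.on product_space.
HB.instance Definition _ :=
  @isMeasurable.Build (product_display d) product_space
  <<s coordinate_sets >> (@sigma_algebra0 _ setT coordinate_sets)
  (@sigma_algebraC _ coordinate_sets)
  (@sigma_algebra_bigcup _ setT coordinate_sets).

End product_space.
Arguments product_space I {d} T.

(* The coordinate Y_k, k >= 1, of w : Omega G is w k.-1. *)
Notation Omega G := (product_space nat (borel G)).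

Notation Omegahat G := (product_space int (borel G)).

Section measures.
Context (R : realType).
Local Open Scope ereal_scope.

Definition radon (E : ptopologicalType)
    (lambda : {measure set (borel E) -> \bar R}) : Prop :=
  [/\ forall K : set E, compact K -> lambda K < +oo,
      forall A : set (borel E), measurable A ->
        lambda A = ereal_inf [set lambda U | U in
                               [set U : set E | open U /\ A `<=` U]] &
      forall U : set E, open U ->
        lambda U = ereal_sup [set lambda K | K in
                               [set K : set E | compact K /\ K `<=` U]]].

Definition convolution (G : topologicalGroupType) (E : ptopologicalType)
    (act : G -> E -> E) (mu : probability (borel G) R)
    (lambda : {measure set (borel E) -> \bar R}) (B : set (borel E)) : \bar R :=
  \int[mu]_g pushforward lambda (act g : borel E -> borel E) B.

Definition stationary (G : topologicalGroupType) (E : ptopologicalType)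
    (act : G -> E -> E) (mu : probability (borel G) R)
    (lambda : {measure set (borel E) -> \bar R}) : Prop :=
  forall B, measurable B -> convolution act mu lambda B = lambda B.

(* P is the infinite product measure: finite-dimensional cylinders, which
   generate the sigma-algebra of Omega G, have the product probability. *)
Definition is_power_measure (G : topologicalGroupType)
    (mu : probability (borel G) R) (P : probability (Omega G) R) : Prop :=
  forall (n : nat) (B : nat -> set (borel G)),
    (forall i, measurable (B i)) ->
    P [set w | forall i, (i < n)%N -> B i (w i)] = \prod_(i < n) mu (B i).

End measures.

Section skew_product.
Context (G : topologicalGroupType) (E : ptopologicalType).

Definition shift_path (w : Omegahat G) : Omegahat G := fun k => w (k + 1)%R.

Definition positive_part (w : Omegahat G) : Omega G := fun n => w n.+1%:Z.

Definition thetahat (act : G -> E -> E) (p : Omegahat G * borel E) :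
    Omegahat G * borel E :=
  (shift_path p.1, act (positive_part p.1 0%N) p.2).

Definition proj_future (p : Omegahat G * borel E) : Omega G * borel E :=
  (positive_part p.1, p.2).

Context (R : realType).
Implicit Types m : {measure set (Omegahat G * borel E) -> \bar R}.

Definition thetahat_invariant (act : G -> E -> E) m : Prop :=
  forall A, measurable A -> pushforward m (thetahat act) A = m A.

Definition has_projection m (nu : set (Omega G * borel E) -> \bar R) : Prop :=
  forall A, measurable A -> pushforward m proj_future A = nu A.

End skew_product.

(* Main.v *)
From HB Require Import structures.
Require Import Defs.
From mathcomp Require Import all_boot all_order all_algebra.
From mathcomp Require Import all_classical all_reals all_analysis.
From mathcomp Require Import measurable_realfun zify.

Set Implicit Arguments.
Unset Strict Implicit.
Unset Printing Implicit Defensive.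

Import Order.TTheory GRing.Theory Num.Theory.

Local Open Scope classical_set_scope.
Local Open Scope ring_scope.
Local Open Scope ereal_scope.

(** The measure is the law of a two-sided path together with a point, the point
being where the path has carried it at time 0. On the events that ignore the
coordinates Y_k with k <= -n such a measure m is forced: thetahat^n turns them
into events about the future and the point alone, so invariance gives
m A = m (thetahat^-n A), and the right-hand side is prescribed by the
projection. These events, called cylinders below, form an increasing union of
sigma-algebras which generates, and the sets where the point lies in a compact
set have finite mass and cover the space; hence uniqueness.

Existence reads the same formula as a definition. Start at time -n, with
P \x lambda for the future increments and the point, put the value 1
before that time, and apply thetahat^n; this gives a measure, stage n.
Consecutive stages agree on the cylinders of level n because the one-sided skew
product (w, x) |-> (shift w, w_1 x) preserves P \x lambda: the first increment
is independent of the others, so integrating it out replaces lambda by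
mu * lambda, which is lambda by stationarity (future_map_preserves). Passing
from stage n to stage n.+1 is by construction one more application of thetahat,
so the limit will be invariant.

The limit is a projective limit, and countable additivity on the algebra of
cylinders is the whole difficulty. It follows Kolmogorov: decreasing cylinders
of mass larger than e, over a compact set of points, contain closed cylinders
of almost the same mass (closed_cylinder_approx); tightness on G confines each
coordinate to a compact set at the cost of a summable loss
(coordinate_tight); the points surviving these losses lie in a product of
compact sets, and Tychonoff gives a common point (compact_cylinders_vanish).
An abstract extension theorem (projective_limit_measure) concludes. The mass
may be infinite, so additivity is tested on pieces over compact sets only. *)

(** * Extension of a consistent sequence of measures *)

Section image_measure.
Context d1 d2 (T1 : measurableType d1) (T2 : measurableType d2)
  (R : realType) (m : {measure set T1 -> \bar R}) (f : T1 -> T2).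

(** The push-forward with its proof of measurability as an argument, so that it
can be named as a measure. *)
Definition image_measure (mf : measurable_fun setT f) :
  {measure set T2 -> \bar R}.
Proof.
by unshelve refine ((fun g : {measure set T2 -> \bar R} => g) (pushforward m f)).
Defined.

Lemma image_measureE mf A : image_measure mf A = m (f @^-1` A).
Proof. by []. Qed.

End image_measure.

Section projective_limit.
Context d (X : measurableType d) (R : realType).
Context (F : nat -> set (set X)) (m_ : nat -> {measure set X -> \bar R}).
Context (F_measurable : forall n, F n `<=` measurable)
  (F_nd : forall n, F n `<=` F n.+1) (F0 : forall n, F n set0)
  (FU : forall n A B, F n A -> F n B -> F n (A `|` B))
  (FC : forall n A, F n A -> F n (~` A)).
Context (F_gen : measurable `<=` <<s \bigcup_n F n >>).
Context (m_consistent : forall n A, F n A -> m_ n.+1 A = m_ n A).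

Lemma level_le n k : (n <= k)%N -> F n `<=` F k.
Proof.
move=> /subnK <-; elim: (k - n)%N => // i IH; rewrite addSn.
exact: subset_trans IH (@F_nd _).
Qed.

Lemma level_measure n k A : (n <= k)%N -> F n A -> m_ k A = m_ n A.
Proof.
move=> /subnK <- FA; elim: (k - n)%N => // i IH; rewrite addSn m_consistent//.
by apply: level_le FA; exact: leq_addl.
Qed.

(** The choice of a level is immaterial by consistency; a default is returned
on sets without a level. *)
Definition level A := xget 0%N [set n | F n A].

Definition level_content A := m_ (level A) A.

Lemma level_contentE n A : F n A -> level_content A = m_ n A.
Proof.
move=> FA; rewrite /level_content.
have FlA : F (level A) A by exact: (@xgetI _ 0%N [set n | F n A] n FA).
by have [/level_measure->//|/ltnW/level_measure->] := leqP n (level A).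
Qed.

(** A copy of X, whose structure of algebra of sets is the union of the F n
rather than the sigma-algebra of X. *)
Definition leveled : Type := X.

Definition level_sets : set (set leveled) := \bigcup_n F n.

Let level_sets0 : level_sets set0. Proof. by exists 0%N. Qed.

Let level_setsU : setU_closed level_sets.
Proof.
move=> A B [n _ FA] [k _ FB]; exists (maxn n k) => //.
by apply: FU; [apply: level_le FA; exact: leq_maxl
              |apply: level_le FB; exact: leq_maxr].
Qed.

Let level_setsC : setC_closed level_sets.
Proof. by move=> A [n _ FA]; exists n => //; exact: FC. Qed.

HB.instance Definition _ := Pointed.on leveled.
HB.instance Definition _ := isAlgebraOfSets.Build default_measure_display
  leveled level_sets0 level_setsU level_setsC.

Let mu : set leveled -> \bar R := level_content.

Let mu_ge0 A : 0 <= mu A. Proof. exact: measure_ge0. Qed.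

Let mu_additive : measure_function.semi_additive mu.
Proof.
apply/additive2P; first by rewrite /mu /level_content measure0.
move=> A B [n _ FA] [k _ FB] AB0.
have FA' := level_le (leq_maxl n k) FA.
have FB' := level_le (leq_maxr n k) FB.
rewrite /mu (level_contentE FA') (level_contentE FB').
rewrite (level_contentE (FU FA' FB')) measureU//.
  exact: F_measurable FA'.
exact: F_measurable FB'.
Qed.

HB.instance Definition _ := isContent.Build _ _ _ mu mu_ge0 mu_additive.

Context (D : nat -> set X) (FD : forall j, F 0%N (D j))
  (D_nd : nondecreasing_seq D) (D_cover : \bigcup_j D j = setT).
Context (D_vanish : forall j (B : nat -> set X),
  (forall N, exists n, F n (B N)) -> nonincreasing_seq B ->
  (forall N, B N `<=` D j) -> \bigcap_N B N = set0 ->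
  forall eps : R, (0 < eps)%R ->
    exists N n, F n (B N) /\ m_ n (B N) <= eps%:E).

(** Since masses may be infinite, the covered set is first cut by D j. What
the first N sets of the cover leave uncovered of the cut set decreases to the
empty set, hence has small mass for some N. *)
Let mu_sigma_subadditive : measurable_subset_sigma_subadditive mu.
Proof.
move=> A B mB [n _ FA] AB.
have FAD j : F n (A `&` D j).
  rewrite -[A `&` D j]setCK setCI; apply/FC/FU/FC => //; first exact: FC.
  exact: level_le (FD j).
suff muAD j : mu (A `&` D j) <= \sum_(i <oo) mu (B i).
  rewrite /mu (level_contentE FA).
  have cvgAD : m_ n (A `&` D j) @[j --> \oo] --> m_ n A.
    rewrite [A in _ --> m_ n A](_ : _ = \bigcup_j (A `&` D j)); last first.
      by rewrite -setI_bigcupr D_cover setIT.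
    apply: nondecreasing_cvg_mu => [i||i j ij]; first exact/F_measurable/FAD.
      by apply: bigcup_measurable => i _; exact/F_measurable/FAD.
    by apply/subsetPset; apply: setIS; apply/subsetPset; exact: D_nd.
  rewrite -(cvg_lim _ cvgAD)//; apply: lime_le; first exact: cvgP cvgAD.
  by apply: nearW => j; rewrite -(level_contentE (FAD j)); exact: muAD.
apply/lee_addgt0Pr => e e0.
pose C N := (A `&` D j) `\` \big[setU/set0]_(i < N) B i.
have mC N : measurable (C N : set leveled).
  by apply: measurableD; [exists n|exact: bigsetU_measurable].
have [N [k [FCN CNe]]] : exists N k, F k (C N) /\ m_ k (C N) <= e%:E.
  apply: (D_vanish (j := j)) => //.
  - by move=> N; have [k _ ?] := mC N; exists k.
  - move=> N M NM; apply/subsetPset; apply: setDS.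
    by apply: subset_bigsetU.
  - by move=> N x [[]].
  - rewrite -subset0 => x Cx; have [[Ax _] _] := Cx 0%N I.
    have [i _ Bix] := AB _ Ax; have [_ []] := Cx i.+1 I.
    by rewrite big_ord_recr; right.
pose B' i := if i is i'.+1 then B i' else C N.
apply: (@le_trans _ _ (\sum_(i < N.+1) mu (B' i))).
  apply: (@content_subadditive _ _ _ mu).
  - by case=> [|i] _ /=; [exact: mC|exact: mB].
  - by exists n.
  - rewrite big_ord_recl /= => x ADx; rewrite /bump /=.
    have [?|?] := pselect ((\big[setU/set0]_(i < N) B i) x); first by right.
    by left.
rewrite big_ord_recl /= addeC; apply: leeD; last by rewrite /mu (level_contentE FCN).
rewrite -(big_mkord xpredT (fun i => mu (B i))).
exact: nneseries_lim_ge.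
Qed.

HB.instance Definition _ :=
  Content_SigmaSubAdditive_isMeasure.Build _ _ _ mu mu_sigma_subadditive.

(** Consistent measures on an increasing sequence of algebras have a common
extension as soon as their common content vanishes along sequences decreasing
to the empty set inside each D j: this is the Caratheodory extension of that
content. *)
Theorem projective_limit_measure :
  exists m : {measure set X -> \bar R}, forall n A, F n A -> m A = m_ n A.
Proof.
pose T := g_sigma_algebraType (@measurable _ leveled).
have id_measurable : measurable_fun setT (id : T -> X).
  by move=> _ A mA; rewrite setTI; exact: F_gen.
pose nu : {measure set T -> \bar R} := measure_extension mu.
exists (image_measure nu id_measurable) => n A FA.
rewrite -[LHS]/((mu^*)%mu (A : set leveled)) measurable_mu_extE; last by exists n.
exact: level_contentE.
Qed.

End projective_limit.

(** * Regularity with respect to a class of sets *)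

Section regularity.
Context d (X : measurableType d) (R : realType) (nu : {measure set X -> \bar R}).
Context (nu_fin : nu setT < +oo).

Lemma tail_le (K : nat -> set X) (e : R) :
  (forall i, measurable (K i)) -> (0 < e)%R ->
  exists N, nu (\bigcup_i K i `\` \big[setU/set0]_(i < N) K i) <= e%:E.
Proof.
move=> mK e0.
pose G N := \bigcup_i K i `\` \big[setU/set0]_(i < N) K i.
have mG N : measurable (G N).
  by apply: measurableD; [exact: bigcup_measurable|exact: bigsetU_measurable].
have G_cap : \bigcap_N G N = set0.
  rewrite -subset0 => x Gx; have [[i _ Kix] _] := Gx 0%N I.
  by have [_ []] := Gx i.+1 I; rewrite big_ord_recr; right.
have cvgG : nu \o G @ \oo --> 0.
  rewrite -[0](measure0 nu) -G_cap; apply: nonincreasing_cvg_mu => //.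
  - rewrite (le_lt_trans _ nu_fin)// le_measure ?inE//; exact: mG.
  - by rewrite G_cap.
  - move=> N M NM; apply/subsetPset; apply: setDS.
    by apply: subset_bigsetU.
have : \forall N \near \oo, (nu \o G) N < e%:E.
  apply: (cvgG [set y | y < e%:E]); apply: open_nbhs_nbhs; split.
    exact: open_ereal_lt_ereal.
  by rewrite /= lte_fin.
by move=> [N _ /(_ N (leqnn N)) /= /ltW ?]; exists N.
Qed.

Context (C : set (set X)) (C_measurable : C `<=` measurable) (C0 : C set0)
  (CT : C setT) (CU : setU_closed C)
  (CI : forall K : nat -> set X, (forall i, C (K i)) -> C (\bigcap_i K i)).

(** The class C plays the role of the closed sets; L is the complement of an
open set containing A. Stated this way the notion is symmetric under
complement. *)
Definition approximable (A : set X) := forall e : R, (0 < e)%R ->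
  exists K L, [/\ C K, C L, K `<=` A, L `<=` ~` A & nu (~` (K `|` L)) <= e%:E].

Let C_bigsetU (K : nat -> set X) N :
  (forall i, C (K i)) -> C (\big[setU/set0]_(i < N) K i).
Proof. by move=> CK; elim/big_ind : _. Qed.

Lemma approximableC A : approximable A -> approximable (~` A).
Proof.
move=> aA e e0; have [K [L [CK CL KA LA KL]]] := aA e e0.
by exists L, K; rewrite setCK setUC.
Qed.

(** Approximate A i up to e / 2 / 2 ^ i.+1. The intersection of the L i is still
in C, but the union of the K i has to be truncated, which costs another
e / 2. *)
Lemma approximable_bigcup (A : nat -> set X) :
  (forall i, approximable (A i)) -> approximable (\bigcup_i A i).
Proof.
move=> aA e e0; have e20 : (0 < e / 2)%R by rewrite divr_gt0.
have [/= f fP] : {f : nat -> set X * set X & forall i,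
    [/\ C (f i).1, C (f i).2, (f i).1 `<=` A i, (f i).2 `<=` ~` A i &
      nu (~` ((f i).1 `|` (f i).2)) <= (e / 2 / (2 ^ i.+1)%:R)%:E]}.
  apply: (@choice _ _ (fun i (f : set X * set X) => [/\ C f.1, C f.2,
      f.1 `<=` A i, f.2 `<=` ~` A i &
      nu (~` (f.1 `|` f.2)) <= (e / 2 / (2 ^ i.+1)%:R)%:E])) => i.
  have [|K [L KL]] := aA i (e / 2 / (2 ^ i.+1)%:R)%R; last by exists (K, L).
  by rewrite divr_gt0// ltr0n expn_gt0.
pose K i := (f i).1; pose L i := (f i).2.
have CK i : C (K i) by have [] := fP i.
have CL i : C (L i) by have [] := fP i.
have [N KN] := tail_le (fun i => C_measurable (CK i)) e20.
pose Z i := ~` (K i `|` L i).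
have mZ i : measurable (Z i).
  by apply/measurableC/measurableU; exact: C_measurable.
have mK : measurable (\bigcup_i K i `\` \big[setU/set0]_(i < N) K i).
  apply: measurableD; first by apply: bigcup_measurable => i _; exact: C_measurable.
  by apply: bigsetU_measurable => i _; exact: C_measurable.
exists (\big[setU/set0]_(i < N) K i), (\bigcap_i L i); split.
- exact: C_bigsetU.
- exact: CI.
- rewrite -bigcup_mkord => x [i _ Kix]; exists i => //.
  by have [_ _ + _ _] := fP i; exact.
- move=> x Lx [i _ Aix]; have [_ _ _ LA _] := fP i.
  exact: LA (Lx i I) Aix.
- apply: (@le_trans _ _ (nu ((\bigcup_i Z i) `|`
      (\bigcup_i K i `\` \big[setU/set0]_(i < N) K i)))).
    apply: le_measure; rewrite ?inE.
    + apply: measurableC; apply: measurableU; last first.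
        by apply: bigcap_measurable => // i _; exact: C_measurable.
      by apply: bigsetU_measurable => i _; exact: C_measurable.
    + by apply: measurableU => //; exact: bigcup_measurable.
    + rewrite setCU => x [Kx /existsNP[i /not_implyP[_ Lix]]].
      have [Kix|Kix] := pselect (K i x); first by right; split => //; exists i.
      by left; exists i => // -[].
  have mUZ : measurable (\bigcup_i Z i) by exact: bigcup_measurable.
  apply: (le_trans (measureU2 _ mUZ mK)).
  rewrite [e in leRHS]splitr EFinD; apply: leeD => //.
  apply: (@le_trans _ _ (\sum_(i <oo) nu (Z i))).
    exact: measure_sigma_subadditive.
  apply: (le_trans _ (epsilon_trick0 xpredT (ltW e20))).
  by apply: lee_nneseries => // i _; have [] := fP i.
Qed.

Lemma sigma_algebra_approximable : sigma_algebra setT approximable.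
Proof.
split.
- move=> e e0; exists set0, setT; split; rewrite ?setC0//.
  by rewrite set0U setCT measure0 lee_fin ltW.
- by move=> A aA; rewrite setTD; exact: approximableC.
- exact: approximable_bigcup.
Qed.

(** The analogue of: a closed set whose complement is F_sigma is
regular. *)
Lemma approximable_inner (K : set X) (H : nat -> set X) :
  C K -> (forall i, C (H i)) -> ~` K = \bigcup_i H i -> approximable K.
Proof.
move=> CK CH KH e e0; have [N HN] := tail_le (fun i => C_measurable (CH i)) e0.
exists K, (\big[setU/set0]_(i < N) H i); split => //; first exact: C_bigsetU.
- by rewrite KH -bigcup_mkord => x [i _ ?]; exists i.
- by rewrite setCU KH -setDE.
Qed.

End regularity.

(** * Locally compact second countable spaces *)

Section lcsc_spaces.

Lemma second_countable_seq (T : topologicalType) : @second_countable T ->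
  exists b : nat -> set T, (forall i, open (b i)) /\
    forall x A, nbhs x A -> exists i, b i x /\ b i `<=` A.
Proof.
move=> [B /countable_injP[f f_inj] [B_open B_nbhs]].
pose b i := xget (set0 : set T) [set U | B U /\ f U = i].
exists b; split=> [i|x A Ax].
  by rewrite /b; case: xgetP => [U _ [BU _]|_]; [exact: B_open|exact: open0].
have [U [BU Ux] UA] := B_nbhs x A Ax; exists (f U).
suff -> : b (f U) = U by [].
have [BV fV] : [set U' | B U' /\ f U' = f U] (b (f U)) by exact: (@xgetI _ _ _ U).
by apply: f_inj; rewrite ?inE.
Qed.

(** Local compactness and regularity put between a point and O a neighbourhood
with compact closure inside O, and a basic open set fits in it: the closures of
the countably many basic sets that qualify fill O. *)
Lemma lcsc_open_bigcup_compact (T : topologicalType) (O : set T) :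
  lcsc T -> open O -> exists K : nat -> set T,
    [/\ forall i, compact (K i), forall i, closed (K i) & O = \bigcup_i K i].
Proof.
move=> [hT lcT /second_countable_seq[b [b_open b_nbhs]]] oO.
pose good i := closure (b i) `<=` O /\ compact (closure (b i)).
pose K i := if `[< good i >] then closure (b i) else set0.
exists K; split=> [i|i|].
- by rewrite /K; case: asboolP => [[]//|_]; exact: compact0.
- by rewrite /K; case: asboolP => _; [exact: closed_closure|exact: closed0].
rewrite eqEsubset; split=> [x Ox|x [i _]]; last first.
  by rewrite /K; case: asboolP => // -[+ _]; exact.
have [N] := lcT x I; rewrite withinET => Nx [cN clN].
have ON : nbhs x (O `&` N) by apply: filterI => //; exact: open_nbhs_nbhs.
have [V Vx VON] := compact_regular hT cN Nx ON.
have [i [bix biV]] := b_nbhs x V Vx.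
have biON : closure (b i) `<=` O `&` N.
  by apply: subset_trans VON; exact: closureS.
exists i => //; rewrite /K; case: asboolP => [_|[]]; first exact: subset_closure.
split; first by move=> y /biON[].
by apply: subclosed_compact cN _; [exact: closed_closure|move=> y /biON[]].
Qed.

Lemma lcsc_compact_exhaustion (T : topologicalType) : lcsc T ->
  exists K : nat -> set T, [/\ forall j, compact (K j), forall j, closed (K j),
    nondecreasing_seq K & \bigcup_j K j = setT].
Proof.
move=> lcT; have [K [cK clK KT]] := lcsc_open_bigcup_compact lcT openT.
exists (fun j => \big[setU/set0]_(i < j.+1) K i); split=> [j|j|i j ij|].
- exact: bigsetU_compact.
- by rewrite -bigcup_mkord; apply: closed_bigcup => //; exact: finite_II.
- by apply/subsetPset; exact: subset_bigsetU.
- rewrite -subTset KT => x [i _ Kix]; exists i => //.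
  by rewrite big_ord_recr; right.
Qed.

Lemma open_measurable_borel (T : ptopologicalType) (O : set T) :
  open O -> measurable (O : set (borel T)).
Proof. by move=> oO; exact: sub_sigma_algebra. Qed.

Lemma closed_measurable_borel (T : ptopologicalType) (K : set T) :
  closed K -> measurable (K : set (borel T)).
Proof.
move=> cK; rewrite -[K]setCK; apply: measurableC; apply: open_measurable_borel.
exact: closed_openC.
Qed.

Lemma lcsc_tight (T : ptopologicalType) (R : realType)
    (nu : {measure set (borel T) -> \bar R}) (e : R) :
  lcsc T -> nu setT < +oo -> (0 < e)%R ->
  exists K : set T, [/\ compact K, closed K & nu (~` K) <= e%:E].
Proof.
move=> lcT nu_fin e0.
have [K [cK clK KT]] := lcsc_open_bigcup_compact lcT (@openT T).
have mK i : measurable (K i : set (borel T)) by exact: closed_measurable_borel.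
have [N KN] := tail_le nu_fin mK e0.
exists (\big[setU/set0]_(i < N) K i); split.
- exact: bigsetU_compact.
- by rewrite -bigcup_mkord; apply: closed_bigcup => //; exact: finite_II.
- by rewrite -setTD KT.
Qed.

(** Second countability makes an open subset of U * V a countable union of
rectangles; otherwise the Borel sets of the product could exceed the product
sigma-algebra. *)
Lemma continuous_measurable_prod (U V W : ptopologicalType) (f : U * V -> W) :
  @second_countable U -> @second_countable V -> continuous f ->
  measurable_fun setT (f : borel U * borel V -> borel W).
Proof.
move=> /second_countable_seq[b [b_open b_nbhs]].
move=> /second_countable_seq[c [c_open c_nbhs]] f_cont.
apply: (@measurability _ _ (borel U * borel V)%type (borel W)
  setT f (@open W)) => [//|/= _ [Q oQ <-]].
rewrite setTI.
have oF : open (f @^-1` Q) by move/continuousP : f_cont; exact.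
pose Z i j : set (borel U * borel V) :=
  if `[< b i `*` c j `<=` f @^-1` Q >] then b i `*` c j else set0.
have -> : f @^-1` Q = \bigcup_i \bigcup_j Z i j.
  rewrite eqEsubset; split=> [[x y] Qxy|z [i _ [j _]]]; last first.
    by rewrite /Z; case: asboolP => // + bc; exact.
  have /= [[A B] /= [Ax By] AB] : nbhs (x, y) (f @^-1` Q).
    exact: open_nbhs_nbhs.
  have [i [bx bA]] := b_nbhs x A Ax; have [j [cy cB]] := c_nbhs y B By.
  exists i => //; exists j => //; rewrite /Z; case: asboolP => // -[].
  by move=> [x' y'] [/= /bA ? /cB ?]; exact: AB.
apply: bigcup_measurable => i _; apply: bigcup_measurable => j _; rewrite /Z.
case: asboolP => _; last exact: measurable0.
by apply: measurableX; exact: open_measurable_borel.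
Qed.

End lcsc_spaces.

(** * Paths and cylinders *)

Section product_space_measurability.

Lemma measurable_coordinate (I : Type) d (T : measurableType d) (i : I) :
  measurable_fun setT (fun w : product_space I T => w i).
Proof.
move=> _ A mA; apply: sub_sigma_algebra; exists i => //.
by exists A.
Qed.

Lemma measurable_path (I : Type) d (T : measurableType d) d'
    (S : measurableType d') (f : S -> product_space I T) :
  (forall i, measurable_fun setT (fun s => f s i)) -> measurable_fun setT f.
Proof.
move=> mf; apply: (@measurability _ _ S (product_space I T) setT f
  (@coordinate_sets I d T)) => [//|/= _ [_ [i _ [A mA <-]] <-]].
by rewrite !setTI; have := mf i measurableT A mA; rewrite setTI.
Qed.

(** Induction on the measurable sets of paths with a point: the events that
test one coordinate, or the point, against an open set generate. *)
Lemma path_borel_measurable_ind (I : Type) (T E : ptopologicalType)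
    (S : set (set (product_space I (borel T) * borel E))) :
  sigma_algebra setT S ->
  (forall i Q, open Q -> S [set p | Q (p.1 i)]) ->
  (forall Q, open Q -> S [set p | Q p.2]) ->
  measurable `<=` S.
Proof.
move=> [S0 SC SU] S1 S2.
have pull (V : Type) (f : product_space I (borel T) * borel E -> V) :
    sigma_algebra setT [set A | S (f @^-1` A)].
  split=> [|A|A SA] /=; first by rewrite preimage_set0.
  - by move=> /SC; rewrite setTD setTD preimage_setC.
  - by rewrite preimage_bigcup; exact: SU.
have Sfst : measurable `<=` [set A | S (fst @^-1` A)].
  apply: smallest_sub => // _ [i _ [A mA <-]]; rewrite setTI /=.
  suff : measurable `<=` [set A | S [set p | A (p.1 i)]] by exact.
  by apply: smallest_sub; [exact: (pull _ (fun p => p.1 i))|exact: S1].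
have Ssnd : measurable `<=` [set A | S (snd @^-1` A)].
  by apply: smallest_sub.
rewrite measurable_prod_measurableType; apply: smallest_sub; first by split.
move=> _ [A mA [B mB <-]].
have -> : A `*` B = ~` (\bigcup_i (bigcup2 (~` (fst @^-1` A)) (~` (snd @^-1` B)) i)).
  by rewrite bigcup2E -setCI setCK.
rewrite -setTD; apply/SC/SU => -[|[|i]] /=; rewrite -?setTD //.
  exact/SC/Sfst.
exact/SC/Ssnd.
Qed.

End product_space_measurability.

Section cylinders.
Context (G : topologicalGroupType) (E : ptopologicalType) (act : G -> E -> E).
Local Notation X := (Omegahat G * borel E)%type.

Definition agree (n : nat) (p q : X) :=
  (forall k : int, (- n%:Z < k)%R -> p.1 k = q.1 k) /\ p.2 = q.2.

(** The events of level n, which depend on the coordinates Y_k with k > -n and on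
the point. Saying this by invariance under agreement, rather than by a
preimage, makes the closure properties immediate. *)
Definition cylinder (n : nat) : set (set X) :=
  [set A | measurable A /\ forall p q, agree n p q -> A p -> A q].

(** A representative of the class of p for agree n. *)
Definition reset (n : nat) (p : X) : X :=
  ((fun k : int => if (- n%:Z < k)%R then p.1 k else 1%g), p.2).

(** A section of the projection to the future. *)
Definition extend (q : Omega G * borel E) : X :=
  ((fun k : int => if k is Posz j.+1 then q.1 j else 1%g), q.2).

Lemma agree_sym n p q : agree n p q -> agree n q p.
Proof. by move=> [pq1 pq2]; split=> // k nk; rewrite pq1. Qed.

Lemma agree_le n k p q : (n <= k)%N -> agree k p q -> agree n p q.
Proof.
move=> nk [pq ?]; split=> // i ni; apply: pq.
by apply: le_lt_trans ni; rewrite lerN2 lez_nat.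
Qed.

Lemma agree_reset n p : agree n p (reset n p).
Proof. by split=> //= k ->. Qed.

Lemma agree_extend p : agree 0%N p (extend (proj_future p)).
Proof. by split=> //= -[[|k]|k]. Qed.

(** The shift makes one more past coordinate known, and the new point uses only
Y_1, which is known. *)
Lemma agree_thetahat n p q :
  agree n p q -> agree n.+1 (thetahat act p) (thetahat act q).
Proof.
move=> [pq1 pq2]; split=> [k nk|] /=.
  by rewrite /shift_path pq1//; lia.
by rewrite /positive_part pq1 ?pq2//; lia.
Qed.

Lemma cylinder_iff n A p q : cylinder n A -> agree n p q -> A p <-> A q.
Proof.
by move=> [_ cA] pq; split; apply: cA => //; exact: agree_sym.
Qed.

Lemma cylinder_measurable n : cylinder n `<=` measurable.
Proof. by move=> A []. Qed.

Lemma cylinder_le n k : (n <= k)%N -> cylinder n `<=` cylinder k.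
Proof.
move=> nk A [mA cA]; split=> // p q pq; apply: cA.
exact: agree_le pq.
Qed.

Lemma cylinder0 n : cylinder n set0.
Proof. by []. Qed.

Lemma cylinderC n A : cylinder n A -> cylinder n (~` A).
Proof.
move=> cA; split; first by apply: measurableC; case: cA.
by move=> p q pq; have [_ qp] := cylinder_iff cA pq => /= nAp /qp.
Qed.

Lemma cylinderU n A B : cylinder n A -> cylinder n B -> cylinder n (A `|` B).
Proof.
move=> [mA cA] [mB cB]; split; first exact: measurableU.
by move=> p q pq [/(cA _ _ pq)|/(cB _ _ pq)]; [left|right].
Qed.

Lemma cylinderD n A B : cylinder n A -> cylinder n B -> cylinder n (A `\` B).
Proof.
move=> cA cB; rewrite setDE -[A]setCK -setCU.
by apply/cylinderC/cylinderU => //; exact: cylinderC.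
Qed.

Lemma cylinder_bigcap n (A : nat -> set X) :
  (forall i, cylinder n (A i)) -> cylinder n (\bigcap_i A i).
Proof.
move=> cA; split; first by apply: bigcap_measurable => // i _; case: (cA i).
by move=> p q pq Ap i _; have [_ + ] := cA i; apply; [exact: pq|exact: Ap].
Qed.

Lemma measurable_coord k : measurable_fun setT (fun p : X => p.1 k).
Proof. exact: (measurableT_comp (measurable_coordinate k) measurable_fst). Qed.

Lemma cylinder_coord n k (B : set (borel G)) :
  measurable B -> (- n%:Z < k)%R -> cylinder n [set p | B (p.1 k)].
Proof.
move=> mB nk; split.
  by have := measurable_coord k measurableT mB; rewrite setTI.
by move=> p q [/(_ _ nk) /= ->].
Qed.

Lemma cylinder_snd n (B : set (borel E)) :
  measurable B -> cylinder n [set p | B p.2].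
Proof.
move=> mB; split; last by move=> p q [_ /= ->].
by have := @measurable_snd _ _ (Omegahat G) (borel E) measurableT B mB; rewrite setTI.
Qed.

Lemma measurable_cylinders : measurable `<=` <<s \bigcup_n cylinder n >>.
Proof.
apply: path_borel_measurable_ind; first exact: smallest_sigma_algebra.
- move=> k Q oQ; apply: sub_sigma_algebra; exists `|k|.+1 => //.
  by apply: cylinder_coord; [exact: open_measurable_borel|lia].
- move=> Q oQ; apply: sub_sigma_algebra; exists 0%N => //.
  by apply: cylinder_snd; exact: open_measurable_borel.
Qed.

Lemma cylinders_measurable : \bigcup_n cylinder n `<=` measurable.
Proof. by move=> A [n _ [? ?]]. Qed.

Lemma measurableE_cylinders : @measurable _ X = <<s \bigcup_n cylinder n >>.
Proof.
rewrite eqEsubset; split; first exact: measurable_cylinders.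
apply: smallest_sub; first exact: sigma_algebra_measurable.
exact: cylinders_measurable.
Qed.

Lemma cylinders_setI : setI_closed (\bigcup_n cylinder n).
Proof.
move=> A B [n _ cA] [k _ cB]; exists (maxn n k) => //.
rewrite -[A `&` B]setCK setCI; apply/cylinderC/cylinderU; apply: cylinderC.
  by apply: cylinder_le cA; exact: leq_maxl.
by apply: cylinder_le cB; exact: leq_maxr.
Qed.

Lemma measurable_extend : measurable_fun setT extend.
Proof.
apply/measurable_fun_pairP; split; last exact: measurable_snd.
apply: measurable_path => -[[|j]|j] /=; do ?exact: measurable_cst.
exact: (measurableT_comp (measurable_coordinate j) measurable_fst).
Qed.

Lemma measurable_proj_future : measurable_fun setT (@proj_future G E).
Proof.
apply/measurable_fun_pairP; split; last exact: measurable_snd.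
by apply: measurable_path => j; exact: measurable_coord.
Qed.

Context (m_act : measurable_fun setT
  (fun p : borel G * borel E => act p.1 p.2 : borel E)).

Lemma measurable_thetahat : measurable_fun setT (thetahat act).
Proof.
apply/measurable_fun_pairP; split.
  by apply: measurable_path => k; exact: measurable_coord.
have m_pair : measurable_fun setT
    (fun p : X => (p.1 1%:Z, p.2) : borel G * borel E).
  apply/measurable_fun_pairP.
  by split; [exact: measurable_coord|exact: measurable_snd].
exact: (measurableT_comp m_act m_pair).
Qed.

Lemma cylinder_preimage_thetahat n A :
  cylinder n.+1 A -> cylinder n (thetahat act @^-1` A).
Proof.
move=> [mA cA]; split.
  by have := measurable_thetahat measurableT mA; rewrite setTI.
by move=> p q pq; apply: cA; exact: agree_thetahat.
Qed.

Lemma cylinder_preimage_iter n A :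
  cylinder n A -> cylinder 0 (iter n (thetahat act) @^-1` A).
Proof.
elim: n A => [//|n IH] A /cylinder_preimage_thetahat /IH.
by rewrite /preimage /=.
Qed.

(** The path whose coordinates of index > -n are those of q, seen from the
present, the point having been moved along by the first n of them. *)
Definition unfold_past n (q : Omega G * borel E) := iter n (thetahat act) (extend q).

Lemma measurable_unfold_past n : measurable_fun setT (unfold_past n).
Proof.
elim: n => [|n IH]; first exact: measurable_extend.
exact: (measurableT_comp measurable_thetahat IH).
Qed.

End cylinders.

(** * The one-sided skew product *)

Section sigma_finite_copy.
Context d (T : measurableType d) (R : realType) (l : {measure set T -> \bar R}).

(** The function l itself, tagged with a proof of sigma-finiteness, so that
product measures with l as second factor are definitionally unchanged. *)
Definition sigma_finite_copy of sigma_finite setT l : set T -> \bar R := l.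

Context (l_sigma_finite : sigma_finite setT l).
Let nu := sigma_finite_copy l_sigma_finite.

HB.instance Definition _ := isMeasure.Build _ _ _ nu
  (measure0 l) (measure_ge0 l) (@measure_semi_sigma_additive _ _ _ l).
HB.instance Definition _ := Measure_isSigmaFinite.Build _ _ _ nu l_sigma_finite.

End sigma_finite_copy.

Section power_measure.
Context (R : realType) (G : topologicalGroupType) (mu : probability (borel G) R)
  (P : probability (Omega G) R).

Definition cons_path (p : borel G * Omega G) : Omega G :=
  fun j => if j is i.+1 then p.2 i else p.1.

Lemma measurable_cons_path : measurable_fun setT cons_path.
Proof.
apply: measurable_path => -[|j]; first exact: measurable_fst.
exact: (measurableT_comp (measurable_coordinate j) measurable_snd).
Qed.

Let boxes : set (set (Omega G)) := [set A | exists n (B : nat -> set (borel G)),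
  (forall i, measurable (B i)) /\ A = [set w | forall i, (i < n)%N -> B i (w i)]].

Let measurable_boxes : @measurable _ (Omega G) = <<s boxes >>.
Proof.
rewrite eqEsubset; split; apply: smallest_sub.
- exact: smallest_sigma_algebra.
- move=> _ [i _ [B mB <-]]; apply: sub_sigma_algebra.
  exists i.+1, (fun j => if j == i then B else setT); split=> [j|].
    by case: ifP.
  rewrite setTI; apply/seteqP; split=> w /=; last first.
    by move=> /(_ i (leqnn _)); rewrite eqxx.
  by move=> Bwi j _; case: eqP => // ->.
- exact: sigma_algebra_measurable.
- move=> _ [n [B [mB ->]]].
  have -> : [set w : Omega G | forall i, (i < n)%N -> B i (w i)] =
      \bigcap_(i in `I_n) [set w | B i (w i)].
    by apply/seteqP; split.
  apply: bigcap_measurableType => i _.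
  by have := measurable_coordinate i measurableT (mB i); rewrite setTI.
Qed.

Let boxes_setI : setI_closed boxes.
Proof.
move=> _ _ [n [B [mB ->]]] [k [C [mC ->]]].
exists (maxn n k), (fun i => (if (i < n)%N then B i else setT) `&`
  (if (i < k)%N then C i else setT)); split=> [i|].
  by apply: measurableI; case: ifP.
apply/seteqP; split=> w /=.
  by move=> [Bw Cw] i _; split; case: ifP => // ?; [exact: Bw|exact: Cw].
move=> BCw; split=> i ik; have := BCw i; rewrite leq_max ik ?orbT.
  by move=> /(_ isT) [].
by move=> /(_ isT) [].
Qed.

(** Independence of the first coordinate from the others: both sides are
probabilities with the same values on finite-dimensional boxes. *)
Lemma power_measure_cons : is_power_measure mu P ->
  forall A, measurable A -> P A = (mu \x P) (cons_path @^-1` A).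
Proof.
move=> P_def A mA; rewrite -(image_measureE (mu \x P) measurable_cons_path).
apply: (measure_unique boxes (fun=> setT) measurable_boxes boxes_setI) => //.
- move=> _; exists 0%N, (fun=> setT); split=> //.
  by apply/seteqP; split.
- by rewrite bigcup_const.
- move=> _ [n [B [mB ->]]]; rewrite image_measureE.
  transitivity (\prod_(i < n) mu (B i)); first exact: P_def.
  case: n => [|n].
    rewrite big_ord0 (_ : _ @^-1` _ = setT `*` setT); last first.
      by apply/seteqP; split.
    apply/esym; etransitivity; first exact: product_measure1E.
    by rewrite /= !probability_setT mule1.
  rewrite (_ : _ @^-1` _ =
      B 0%N `*` [set w | forall i, (i < n)%N -> B i.+1 (w i)]); last first.
    apply/seteqP; split=> -[g w] /=.
      by move=> Bgw; split=> [|i ik]; [exact: (Bgw 0%N)|exact: (Bgw i.+1)].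
    by move=> [Bg Bw] [|i] // ik; exact: Bw.
  apply/esym; etransitivity.
    apply: product_measure1E => //; rewrite measurable_boxes.
    by apply: sub_sigma_algebra; exists n, (fun i => B i.+1).
  rewrite big_ord_recl; congr (_ * _).
  exact: (P_def n (fun i => B i.+1) (fun i => mB i.+1)).
- move=> _; have PT : P setT = 1 by exact: probability_setT.
  by change (P setT < +oo); rewrite PT ltry.
Qed.

End power_measure.

Section future_dynamics.
Context (R : realType) (G : topologicalGroupType) (E : ptopologicalType)
  (act : G -> E -> E) (mu : probability (borel G) R)
  (lambda : {sigma_finite_measure set (borel E) -> \bar R})
  (P : probability (Omega G) R).
Context (m_act : measurable_fun setT
  (fun p : borel G * borel E => act p.1 p.2 : borel E)).
Context (stat_lambda : stationary act mu lambda) (P_def : is_power_measure mu P).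

Definition future_map (q : Omega G * borel E) : Omega G * borel E :=
  ((fun j => q.1 j.+1), act (q.1 0%N) q.2).

Lemma measurable_future_map : measurable_fun setT future_map.
Proof.
apply/measurable_fun_pairP; split.
  apply: measurable_path => j.
  exact: (measurableT_comp (measurable_coordinate j.+1) measurable_fst).
have m_pair : measurable_fun setT
    (fun q : Omega G * borel E => (q.1 0%N, q.2) : borel G * borel E).
  apply/measurable_fun_pairP; split; last exact: measurable_snd.
  exact: (measurableT_comp (measurable_coordinate 0%N) measurable_fst).
exact: (measurableT_comp m_act m_pair).
Qed.

Lemma measurable_act_preimage (C : set (borel E)) : measurable C ->
  measurable_fun setT (fun g : borel G => lambda (act g @^-1` C)).
Proof.
move=> mC.
have mF : measurable ((fun p : borel G * borel E => act p.1 p.2 : borel E) @^-1` C).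
  by have := m_act measurableT mC; rewrite setTI.
apply: eq_measurable_fun (measurable_fun_xsection lambda mF) => g _ /=.
by congr (lambda _); apply/seteqP; split=> x /=; rewrite /xsection /= inE.
Qed.

(** On a rectangle B * C the left-hand side is the integral of
1_B (shift w) lambda (w_1^-1 C). Independence splits it as
P B * (mu * lambda) C, where stationarity enters. *)
Lemma future_map_preserves (A : set (Omega G * borel E)) : measurable A ->
  (P \x lambda) (future_map @^-1` A) = (P \x lambda) A.
Proof.
move=> mA; rewrite -(image_measureE (P \x lambda) measurable_future_map).
apply/esym; apply: product_measure_unique => // {A mA} B C mB mC.
rewrite image_measureE /product_measure1.
pose f (g : borel G) := lambda (act g @^-1` C).
have mf : measurable_fun setT f by exact: measurable_act_preimage.
pose F (w : Omega G) := (\1_B (fun j => w j.+1 : borel G))%:E * f (w 0%N).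
have mshift : measurable_fun setT (fun w : Omega G => (fun j => w j.+1) : Omega G).
  by apply: measurable_path => j; exact: measurable_coordinate.
have mF : measurable_fun setT F.
  apply: emeasurable_funM; last exact: (measurableT_comp mf (measurable_coordinate 0%N)).
  apply/measurable_EFinP.
  have m1B : measurable_fun setT (\1_B : Omega G -> R) by exact: measurable_indic.
  exact: (measurableT_comp m1B mshift).
have F0 w : 0 <= F w by rewrite mule_ge0// lee_fin.
transitivity (\int[P]_w F w).
  apply: eq_integral => w _ /=; rewrite /F /f indicE.
  have [wB|wB] := boolP (_ \in B).
    rewrite mul1e; congr (lambda _); apply/seteqP; split=> x; rewrite /xsection /= inE.
      by move=> [].
    by move=> ?; split=> //; exact/set_mem.
  rewrite mul0e (_ : xsection _ _ = set0) ?measure0//.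
  rewrite -subset0 => x; rewrite /xsection /= inE => -[/= wB' _].
  by move: wB; rewrite notin_setE.
rewrite (eq_measure_integral
  (image_measure (mu \x P) (@measurable_cons_path G))); last first.
  by move=> A mA _; exact: power_measure_cons.
rewrite ge0_integral_pushforward//; last exact: measurable_cons_path.
have mFcons := measurableT_comp mF (@measurable_cons_path G).
rewrite preimage_setT fubini_tonelli1//; last by move=> p; exact: F0.
transitivity (\int[mu]_g (P B * f g)).
  apply: eq_integral => g _; rewrite /fubini_F /F /=.
  rewrite ge0_integralZr//; first by rewrite integral_indic// setIT.
    by apply/measurable_EFinP; exact: measurable_indic.
rewrite ge0_integralZl//; congr (_ * _); exact: stat_lambda.
Qed.

End future_dynamics.

(** * Approximations of the invariant measure *)

Section natural_extension.
Context (R : realType) (G : topologicalGroupType) (E : ptopologicalType)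
  (act : G -> E -> E) (mu : probability (borel G) R)
  (lambda : {sigma_finite_measure set (borel E) -> \bar R})
  (P : probability (Omega G) R).
Context (m_act : measurable_fun setT
  (fun p : borel G * borel E => act p.1 p.2 : borel E)).
Context (stat_lambda : stationary act mu lambda) (P_def : is_power_measure mu P).
Local Notation X := (Omegahat G * borel E)%type.

(** The n-th approximation of the invariant measure: the right law for the
coordinates Y_k with k > -n and the point, and constant coordinates before. *)
Definition stage (n : nat) : {measure set X -> \bar R} :=
  image_measure (P \x lambda) (measurable_unfold_past m_act n).

(** The future of thetahat applied to an extension of q is the one-sided skew
product applied to q, whatever past was chosen. *)
Lemma proj_unfold1 q :
  proj_future (unfold_past act 1 q) = future_map act q.
Proof. case: q => w x; congr pair; apply/funext => j.
rewrite /positive_part /= /shift_path.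
by have -> : (j.+1%:Z + 1 = j.+2%:Z)%R by lia.
Qed.

Lemma cylinder0_extend (A : set X) : cylinder 0 A ->
  @proj_future G E @^-1` (@extend G E @^-1` A) = A.
Proof.
move=> cA; apply/seteqP; split=> p /=;
  by have [? ?] := cylinder_iff cA (agree_extend p).
Qed.

Lemma extend_preimage_measurable (A : set X) :
  measurable A -> measurable (@extend G E @^-1` A).
Proof.
by move=> mA; have := @measurable_extend G E measurableT A mA; rewrite setTI.
Qed.

(** Pulling A back by thetahat^n gives an event about the future, for which
stages 1 and 0 differ by one step of the one-sided skew product. *)
Lemma stage_consistent n A : cylinder n A -> stage n.+1 A = stage n A.
Proof.
move=> cA; rewrite /stage !image_measureE.
have cA' := cylinder_preimage_iter m_act cA.
have [mA' _] := cA'.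
have -> : unfold_past act n.+1 @^-1` A =
    future_map act @^-1` (@extend G E @^-1` (iter n (thetahat act) @^-1` A)).
  have past q : A (unfold_past act n.+1 q) =
      (iter n (thetahat act) @^-1` A) (unfold_past act 1 q).
    by rewrite /unfold_past iterSr.
  apply/funext => q; rewrite [LHS]past; apply/propext.
  rewrite [X in _ <-> X](_ : _ = (iter n (thetahat act) @^-1` A)
    (extend (proj_future (unfold_past act 1 q)))); last by rewrite proj_unfold1.
  exact: cylinder_iff cA' (agree_extend _).
exact: (future_map_preserves m_act stat_lambda P_def
  (extend_preimage_measurable mA')).
Qed.

Lemma stage0_proj A : measurable A ->
  stage 0 (@proj_future G E @^-1` A) = (P \x lambda) A.
Proof.
move=> mA; rewrite /stage image_measureE; congr ((P \x lambda) _).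
by apply/seteqP; split=> -[].
Qed.

Lemma stage0_snd (B : set (borel E)) : measurable B ->
  stage 0 [set p | B p.2] = lambda B.
Proof.
move=> mB; rewrite -[[set p | B p.2]]/(@proj_future G E @^-1` [set q | B q.2]).
have -> : [set q : Omega G * borel E | B q.2] = setT `*` B.
  by apply/seteqP; split=> q //= [].
rewrite stage0_proj; last exact: measurableX.
apply: etrans; first exact: product_measure1E.
by rewrite [X in X * _](@probability_setT _ _ _ P) mul1e.
Qed.

Lemma stage_snd n (B : set (borel E)) : measurable B ->
  stage n [set p | B p.2] = lambda B.
Proof.
move=> mB; rewrite -stage0_snd//; elim: n => // n IH.
by rewrite stage_consistent//; exact: cylinder_snd.
Qed.

End natural_extension.

(** * The Kolmogorov compactness argument *)

Section kolmogorov.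
Context (R : realType) (G : topologicalGroupType) (E : ptopologicalType)
  (lcscG : lcsc G) (lcscE : lcsc E).
Local Notation X := (Omegahat G * borel E)%type.
Local Notation Y := (prod_topology (fun _ : int => G) * E)%type.

Definition closed_cylinder n : set (set X) :=
  [set H | closed (H : set Y) /\ cylinder n H].

Let closed_cylinder_measurable n : closed_cylinder n `<=` measurable.
Proof. by move=> H [_ []]. Qed.

Let closed_cylinder0 n : closed_cylinder n set0.
Proof. by split; [exact: closed0|exact: cylinder0]. Qed.

Let closed_cylinderT n : closed_cylinder n setT.
Proof.
split; first exact: closedT.
by rewrite -setC0; exact/cylinderC/cylinder0.
Qed.

Let closed_cylinderU n : setU_closed (closed_cylinder n).
Proof.
move=> A B [clA cA] [clB cB]; split; first exact: closedU.
exact: cylinderU.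
Qed.

Let closed_cylinder_bigcap n (H : nat -> set X) :
  (forall i, closed_cylinder n (H i)) -> closed_cylinder n (\bigcap_i H i).
Proof.
move=> cH; split; last by apply: cylinder_bigcap => i; case: (cH i).
by apply: closed_bigI => i _; case: (cH i).
Qed.

Let reset_coord_continuous n (k : int) :
  continuous ((fun p : X => (reset n p).1 k) : Y -> G).
Proof.
rewrite /reset /=; case: (- n%:Z < k)%R; last exact: cst_continuous.
move=> p; apply: (@continuous_comp _ _ _ (fst : Y -> _)
  (proj k : prod_topology (fun _ : int => G) -> G)).
  exact: cvg_fst.
exact: proj_continuous.
Qed.

Let closed_cylinder_coord n k (K : set G) :
  closed K -> closed_cylinder n [set p | K ((reset n p).1 k)].
Proof.
move=> clK; split.
  apply: (@preimage_closed Y G (fun p : X => (reset n p).1 k) K _ clK) => p _.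
  exact: reset_coord_continuous.
rewrite /reset /=; case nk : (- n%:Z < k)%R.
  by apply: cylinder_coord => //; exact: closed_measurable_borel.
have [K1|K1] := pselect (K 1%g).
  by rewrite (_ : [set _ | _] = setT);
    [case: (closed_cylinderT n)|apply/seteqP; split].
by rewrite (_ : [set _ | _] = set0); [exact: cylinder0|apply/seteqP; split].
Qed.

Let closed_cylinder_snd n (K : set E) :
  closed K -> closed_cylinder n [set p | K p.2].
Proof.
move=> clK; split; last by apply: cylinder_snd; exact: closed_measurable_borel.
by apply: (@preimage_closed Y E snd K _ clK) => p _; exact: cvg_snd.
Qed.

(** Inner regularity with a control on the level: the sets whose preimage under
reset n is approximable by closed cylinders of level n form a sigma-algebra,
which contains the coordinate events because open sets of G and E are unions of
countably many closed sets. A cylinder of level n is its own preimage. *)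
Lemma closed_cylinder_approx (nu : {measure set X -> \bar R}) n A (e : R) :
  nu setT < +oo -> cylinder n A -> (0 < e)%R ->
  exists H, [/\ closed (H : set Y), cylinder n H, H `<=` A & nu (A `\` H) <= e%:E].
Proof.
move=> nu_fin cA e0; have [mA _] := cA.
pose C := closed_cylinder n.
have reset_A : reset n @^-1` A = A.
  by apply/seteqP; split=> p; have [? ?] := cylinder_iff cA (agree_reset n p).
suff approx_A : approximable nu C (reset n @^-1` A).
  have [K [L [[clK cK] [_ cL] KA LA KL]]] := approx_A e e0.
  rewrite reset_A in KA LA; exists K; split=> //.
  apply: le_trans KL; apply: le_measure; rewrite ?inE.
  - by apply: measurableD => //; case: cK.
  - by apply/measurableC/measurableU; [case: cK|case: cL].
  - by move=> p [Ap nKp] [//|/LA].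
suff : measurable `<=` [set A | approximable nu C (reset n @^-1` A)] by exact.
have saC : sigma_algebra setT (approximable nu C).
  exact: (sigma_algebra_approximable nu_fin (@closed_cylinder_measurable n)
    (closed_cylinder0 n) (closed_cylinderT n) (@closed_cylinderU n)
    (@closed_cylinder_bigcap n)).
have open_approx (T : ptopologicalType) (f : X -> T) (Q : set T) : lcsc T ->
    (forall K, closed K -> C (f @^-1` K)) -> open Q ->
    approximable nu C (f @^-1` Q).
  move=> lcT clf oQ; rewrite -[Q]setCK -preimage_setC; apply: approximableC.
  have [K [_ clK QK]] := lcsc_open_bigcup_compact lcT oQ.
  apply: (approximable_inner nu_fin (@closed_cylinder_measurable n)
    (closed_cylinder0 n) (@closed_cylinderU n) (H := fun i => f @^-1` (K i))).
  + by apply: clf; exact: open_closedC.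
  + by move=> i; exact: clf.
  + by rewrite preimage_setC setCK QK preimage_bigcup.
apply: path_borel_measurable_ind.
+ have [C0 CC CU] := saC; split=> /= [|B|B CB].
  * by rewrite preimage_set0.
  * by rewrite setTD -preimage_setC -setTD; exact: CC.
  * by rewrite preimage_bigcup; exact: CU.
+ move=> k Q oQ; apply: (open_approx G (fun p => (reset n p).1 k)) => // K.
  exact: closed_cylinder_coord.
+ move=> Q oQ; apply: (open_approx E snd) => // K; exact: closed_cylinder_snd.
Qed.

(** The point 1 is put in C because it is the value that reset gives to the
forgotten coordinates. *)
Lemma coordinate_tight (m : {measure set X -> \bar R}) (D : set X) (k : int)
    (e : R) : measurable D -> m D < +oo -> (0 < e)%R ->
  exists C : set G, [/\ compact C, closed C, C 1%g &
    m ([set p | (~` C) (p.1 k)] `&` D) <= e%:E].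
Proof.
move=> mD D_fin e0.
pose nu := image_measure (mrestr m mD) (@measurable_coord G E k).
have [|C [cC clC nuC]] := lcsc_tight (nu := nu) lcscG _ e0.
  suff -> : nu setT = m D by [].
  rewrite image_measureE; congr (m _).
  by apply/seteqP; split=> p; [case|split].
have mC := closed_measurable_borel clC.
have cl1 : closed (C `|` [set 1%g]).
  apply: closedU => //; apply: compact_closed; last exact: compact_set1.
  by case: lcscG.
exists (C `|` [set 1%g]); split=> //; last first.
- apply: (@le_trans _ _ (m ([set p | (~` C) (p.1 k)] `&` D))); last exact: nuC.
  apply: le_measure; rewrite ?inE.
  + apply: measurableI => //.
    have := @measurable_coord G E k measurableT _
      (measurableC (closed_measurable_borel cl1)).
    by rewrite setTI.
  + apply: measurableI => //.
    by have := @measurable_coord G E k measurableT _ (measurableC mC); rewrite setTI.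
  + by move=> p [/= nC Dp]; split=> // Cp; apply: nC; left.
- by right.
- by apply: compactU => //; exact: compact_set1.
Qed.

Context (m_ : nat -> {measure set X -> \bar R})
  (m_consistent : forall n A, cylinder n A -> m_ n.+1 A = m_ n A).

Lemma cylinder_measure n k A : (n <= k)%N -> cylinder n A -> m_ k A = m_ n A.
Proof.
apply: (level_measure (F := @cylinder G E)) => // i; exact: cylinder_le.
Qed.

(** If the masses stayed above e, then for each N some point of B N would avoid
the exceptional sets of total mass at most e: it lies in the closed sets H i
with i <= N, and its coordinates of index k > - rho N lie in the compact sets
C k. Resetting its older coordinates to 1 keeps it in the H i, whose level is at
most rho N, and puts all its coordinates in the C k. A cluster point of these
points in the compact product of the C k and K belongs to every H i. *)
Lemma compact_cylinders_vanish (K : set E) (B : nat -> set X) (e : R) :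
  compact K -> (forall n, m_ n [set p | K p.2] < +oo) ->
  (forall N, exists n, cylinder n (B N)) -> nonincreasing_seq B ->
  (forall N, B N `<=` [set p | K p.2]) -> \bigcap_N B N = set0 -> (0 < e)%R ->
  exists N n, cylinder n (B N) /\ m_ n (B N) <= e%:E.
Proof.
move=> cK K_fin cB B_ni BK B0 e0; apply: contrapT => no_small.
pose D := [set p : X | K p.2].
have clK : closed K by apply: compact_closed cK; case: lcscE.
have mK : measurable (K : set (borel E)) by exact: closed_measurable_borel.
have mD : measurable D by case: (@cylinder_snd G E 0 K mK).
have e20 : (0 < e / 2)%R by rewrite divr_gt0.
pose eps (i : nat) := (e / 2 / (2 ^ i.+1)%:R)%R.
have eps0 i : (0 < eps i)%R by rewrite divr_gt0// ltr0n expn_gt0.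
have [r cBr] := choice cB.
(* a majorant of the levels of B 0, ..., B N *)
pose rho N := (\sum_(i < N.+1) r i)%N.
have r_rho i N : (i <= N)%N -> (r i <= rho N)%N.
  move=> iN; rewrite /rho (bigD1 (Ordinal (iN : (i < N.+1)%N))) //=.
  exact: leq_addr.
have inner i : exists H, [/\ closed (H : set Y), cylinder (r i) H, H `<=` B i &
    m_ (r i) (B i `\` H) <= (eps i)%:E].
  have fin : mrestr (m_ (r i)) mD setT < +oo by rewrite /mrestr /= setTI.
  have [H [clH cH HB HBe]] := closed_cylinder_approx fin (cBr i) (eps0 i).
  exists H; split=> //.
  apply: (@le_trans _ _ (m_ (r i) ((B i `\` H) `&` D))); last exact: HBe.
  by rewrite setIidl// => p [/BK].
have [H HP] := choice inner.
have tight (k : int) : exists C : set G, [/\ compact C, closed C, C 1%g &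
    m_ `|k|.+1 ([set p | (~` C) (p.1 k)] `&` D) <= (eps (pickle k))%:E].
  exact: coordinate_tight.
have [C CP] := choice tight.
have cCD (k : int) n : (- n%:Z < k)%R ->
    cylinder n ([set p | (~` C k) (p.1 k)] `&` D).
  move=> nk; rewrite -[_ `&` _]setCK setCI.
  apply/cylinderC/cylinderU; apply/cylinderC; last exact: cylinder_snd.
  apply: cylinder_coord => //; apply: measurableC.
  by apply: closed_measurable_borel; have [] := CP k.
have witness N : exists p : X, [/\ forall i, (i <= N)%N -> H i p,
    forall k : int, C k (p.1 k) & K p.2].
  (* the mass lost by closing B i, and by confining the coordinate with code
     i, when stage rho N determines them *)
  pose ZH i := if (i <= N)%N then B i `\` H i else set0.
  pose ZC i : set X := if @pickle_inv int i is Some k then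
    if (- (rho N)%:Z < k)%R then [set p | (~` C k) (p.1 k)] `&` D else set0
    else set0.
  have cZH i : cylinder (rho N) (ZH i).
    rewrite /ZH; case: ifP => iN; last exact: cylinder0.
    apply: (cylinder_le (r_rho _ _ iN)); apply: cylinderD => //.
    by have [] := HP i.
  have cZC i : cylinder (rho N) (ZC i).
    rewrite /ZC; case: pickle_inv => [k|]; last exact: cylinder0.
    by case: ifP => nk; [exact: cCD|exact: cylinder0].
  have mZH i : measurable (ZH i) by case: (cZH i).
  have mZC i : measurable (ZC i) by case: (cZC i).
  have ZHe i : m_ (rho N) (ZH i) <= (eps i)%:E.
    rewrite /ZH; case: ifP => iN; last by rewrite measure0 lee_fin ltW.
    have [_ cH _ HBe] := HP i.
    by rewrite (cylinder_measure (r_rho _ _ iN))//; exact: cylinderD.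
  have ZCe i : m_ (rho N) (ZC i) <= (eps i)%:E.
    rewrite /ZC; case ki : (pickle_inv i) => [k|]; last by rewrite measure0 lee_fin ltW.
    case: ifP => nk; last by rewrite measure0 lee_fin ltW.
    have [_ _ _] := CP k.
    have -> : pickle k = i by have := @pickle_invK int i; rewrite ki.
    have nk' : (- `|k|.+1%:Z < k)%R by lia.
    (* the bound was obtained at stage `|k|.+1, and the two stages agree on
       an event that both of them determine *)
    rewrite -(cylinder_measure (leq_maxr (rho N) _) (cCD _ _ nk')).
    by rewrite (cylinder_measure (leq_maxl _ `|k|.+1) (cCD _ _ nk)).
  have [p Bp nZ] : exists2 p, B N p & ~ (\bigcup_i ZH i `|` \bigcup_i ZC i) p.
    apply: contrapT => noB; apply: no_small; exists N, (rho N); split.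
      exact: cylinder_le (r_rho _ _ (leqnn N)) _ (cBr N).
    have mUH : measurable (\bigcup_i ZH i) by exact: bigcup_measurable.
    have mUC : measurable (\bigcup_i ZC i) by exact: bigcup_measurable.
    apply: (@le_trans _ _ (m_ (rho N) (\bigcup_i ZH i `|` \bigcup_i ZC i))).
      apply: le_measure; rewrite ?inE; [by case: (cBr N)|exact: measurableU|].
      by move=> p Bp; apply: contrapT => nZ; apply: noB; exists p.
    apply: (le_trans (measureU2 _ mUH mUC)).
    rewrite [e in leRHS]splitr EFinD; apply: leeD.
      apply: (le_trans _ (epsilon_trick0 xpredT (ltW e20))).
      apply: (@le_trans _ _ (\sum_(i <oo) m_ (rho N) (ZH i))).
        exact: measure_sigma_subadditive.
      by apply: lee_nneseries => // i _; exact: ZHe.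
    apply: (le_trans _ (epsilon_trick0 xpredT (ltW e20))).
    apply: (@le_trans _ _ (\sum_(i <oo) m_ (rho N) (ZC i))).
      exact: measure_sigma_subadditive.
    by apply: lee_nneseries => // i _; exact: ZCe.
  exists (reset (rho N) p); split=> [i iN|k|]; last exact: BK Bp.
  - have [_ cH _ _] := HP i.
    have cH' := cylinder_le (r_rho _ _ iN) cH.
    have [+ _] := cylinder_iff cH' (agree_reset (rho N) p); apply.
    have Bip : B i p by have /subsetPset := B_ni _ _ iN; exact.
    apply: contrapT => nHp; apply: nZ; left; exists i => //.
    by rewrite /ZH iN.
  - rewrite /reset /=; case nk : (- (rho N)%:Z < k)%R; last by have [] := CP k.
    apply: contrapT => nCp; apply: nZ; right; exists (pickle k) => //.
    by rewrite /ZC pickleK_inv nk; split=> //; exact: BK Bp.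
have [q qP] := choice witness.
pose S : set Y :=
  [set f : prod_topology (fun _ : int => G) | forall k, C k (f k)] `*` K.
have cS : compact S.
  apply: compact_setX => //; apply: tychonoff => k.
  by have [] := CP k.
have [|p [_ p_cluster]] := cS ((q : nat -> Y) @ \oo) _.
  by exists 0%N => // N _; have [_ Cq Kq] := qP N; split.
suff : (\bigcap_N B N) p by rewrite B0.
move=> i _; have [clH _ HB _] := HP i; apply: HB; apply: clH => V pV.
apply: p_cluster => //; exists i => // N iN.
by have [+ _ _] := qP N; exact.
Qed.

End kolmogorov.

(** * Existence and uniqueness *)

Section invariant_measure.
Context (R : realType) (G : topologicalGroupType) (E : ptopologicalType)
  (act : G -> E -> E) (mu : probability (borel G) R)
  (lambda : {sigma_finite_measure set (borel E) -> \bar R})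
  (P : probability (Omega G) R).
Context (lcscG : lcsc G) (lcscE : lcsc E).
Context (m_act : measurable_fun setT
  (fun p : borel G * borel E => act p.1 p.2 : borel E)).
Context (lambda_compact : forall K : set E, compact K -> lambda K < +oo).
Context (stat_lambda : stationary act mu lambda) (P_def : is_power_measure mu P).
Local Notation X := (Omegahat G * borel E)%type.

Lemma invariant_cylinder (m : {measure set X -> \bar R}) n A :
  thetahat_invariant act m -> cylinder n A ->
  m (iter n (thetahat act) @^-1` A) = m A.
Proof.
move=> m_inv; elim: n A => [//|n IH] A cA.
have [mA _] := cA; apply: etrans (m_inv A mA); apply: IH.
exact: cylinder_preimage_thetahat.
Qed.

(** The formula that forces the values of an invariant measure on
cylinders. *)
Lemma invariant_projection_cylinder (m : {measure set X -> \bar R}) n A :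
  thetahat_invariant act m -> has_projection m (P \x lambda) -> cylinder n A ->
  m A = (P \x lambda) (unfold_past act n @^-1` A).
Proof.
move=> m_inv m_proj cA; rewrite -(invariant_cylinder m_inv cA).
have cA' := cylinder_preimage_iter m_act cA; have [mA' _] := cA'.
rewrite -{1}(cylinder0_extend cA'); exact: m_proj (extend_preimage_measurable mA').
Qed.

Theorem natural_extension : exists m : {measure set X -> \bar R},
  [/\ thetahat_invariant act m, has_projection m (P \x lambda) &
    forall m' : {measure set X -> \bar R},
      thetahat_invariant act m' -> has_projection m' (P \x lambda) ->
      forall A, measurable A -> m' A = m A].
Proof.
have [K [cK clK K_nd KT]] := lcsc_compact_exhaustion lcscE.
have mK j : measurable (K j : set (borel E)) by exact: closed_measurable_borel.
pose m_ n := stage lambda P m_act n.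
have consistent : forall n A, cylinder n A -> m_ n.+1 A = m_ n A.
  exact: (stage_consistent m_act stat_lambda P_def).
have K_fin n j : m_ n [set p | K j p.2] < +oo.
  suff -> : m_ n [set p | K j p.2] = lambda (K j) by exact: lambda_compact.
  exact: (stage_snd m_act stat_lambda P_def n (mK j)).
pose D j := [set p : X | K j p.2].
have cD j : cylinder 0 (D j) by exact: cylinder_snd.
have D_cover : \bigcup_j D j = setT.
  by rewrite -[RHS](preimage_setT (snd : X -> E)) -KT preimage_bigcup.
have [m mE] : exists m : {measure set X -> \bar R},
    forall n A, cylinder n A -> m A = m_ n A.
  apply: (projective_limit_measure (F := @cylinder G E) (m_ := m_)
    _ _ _ _ _ _ consistent cD _ D_cover) => //.
  - exact: cylinder_measurable.
  - by move=> n; exact: cylinder_le.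
  - by move=> n A B; exact: cylinderU.
  - by move=> n A; exact: cylinderC.
  - exact: measurable_cylinders.
  - move=> i j ij; apply/subsetPset => p.
    by have /subsetPset := K_nd _ _ ij; apply.
  - move=> j B cB B_ni BD B0 e e0.
    exact: (compact_cylinders_vanish lcscG lcscE consistent (cK j) (K_fin^~ j) cB).
have m_unique (m1 m2 : {measure set X -> \bar R}) :
    (forall n A, cylinder n A -> m1 A = m2 A) -> (forall j, m1 (D j) < +oo) ->
    forall A, measurable A -> m1 A = m2 A.
  move=> m12 m1D; apply: (measure_unique (\bigcup_n @cylinder G E n) D) => //.
  - exact: measurableE_cylinders.
  - exact: cylinders_setI.
  - by move=> j; exists 0%N.
  - by move=> A [n _ cA]; exact: m12 cA.
have mD j : m (D j) < +oo by rewrite (mE _ _ (cD j)); exact: K_fin.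
have m_inv : thetahat_invariant act m.
  move=> A mA; rewrite /pushforward -(image_measureE m (measurable_thetahat m_act)).
  apply/esym; apply: m_unique => // {mA} n {}A cA.
  have cA' := cylinder_preimage_thetahat m_act (cylinder_le (leqnSn n) cA).
  apply: etrans (mE _ _ (cylinder_le (leqnSn n) cA)) _.
  exact: esym (mE _ _ cA').
have m_proj : has_projection m (P \x lambda).
  move=> A mA; rewrite -(stage0_proj lambda P m_act mA); apply: mE; split.
    by have := @measurable_proj_future G E measurableT A mA; rewrite setTI.
  move=> p q [pq1 pq2]; rewrite /preimage /= /proj_future pq2.
  suff -> : positive_part p.1 = positive_part q.1 by [].
  by apply/funext => j; exact: pq1.
exists m; split=> // m' m'_inv m'_proj A mA.
apply/esym; apply: m_unique => // n {mA}A cA.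
rewrite (invariant_projection_cylinder m_inv m_proj cA).
by rewrite (invariant_projection_cylinder m'_inv m'_proj cA).
Qed.

End invariant_measure.

Theorem proposition4 (R : realType)
    (G : topologicalGroupType) (E : ptopologicalType) (act : G -> E -> E)
    (mu : probability (borel G) R)
    (lambda : {measure set (borel E) -> \bar R})
    (P : probability (Omega G) R)
    (lcscG : lcsc G) (lcscE : lcsc E) (actGE : continuous_action act)
    (radon_lambda : radon lambda) (stat_lambda : stationary act mu lambda)
    (P_def : is_power_measure mu P) :
  exists m : {measure set (Omegahat G * borel E) -> \bar R},
    [/\ thetahat_invariant act m,
        has_projection m (P \x lambda) &
        forall m' : {measure set (Omegahat G * borel E) -> \bar R},
          thetahat_invariant act m' ->
          has_projection m' (P \x lambda) ->
          forall A, measurable A -> m' A = m A].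
Proof.
have [_ _ act_continuous] := actGE; have [_ _ scG] := lcscG; have [_ _ scE] := lcscE.
have m_act := continuous_measurable_prod scG scE act_continuous.
have [lambda_compact _ _] := radon_lambda.
have lambda_sf : sigma_finite setT lambda.
  have [K [cK clK _ KT]] := lcsc_compact_exhaustion lcscE.
  exists K => // j; split; last exact: lambda_compact.
  exact: closed_measurable_borel.
exact: (natural_extension (lambda := sigma_finite_copy lambda_sf) lcscG lcscE
  m_act lambda_compact stat_lambda P_def).
Qed.
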